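(* Let $F=\langle\Sigma,\Delta,Q,\tilde q,f\rangle$ be a finite automaton and let $\omega\in\Sigma^{\mathbb{N}}$ be eventually strongly almost periodic. Then $F(\omega)\in\Delta^{\mathbb{N}}$ is eventually strongly almost periodic.
   Context: A finite automaton is a tuple $F=\langle\Sigma,\Delta,Q,\tilde q,f\rangle$ with finite input alphabet $\Sigma$, finite output alphabet $\Delta$, finite set of states $Q$, initial state $\tilde q\in Q$ and transition function $f\colon Q\times\Sigma\to Q\times\Delta$. For $\alpha\in\Sigma^{\mathbb{N}}$ define $p_0=\tilde q$ and $\langle p_{n+1},\beta(n)\rangle=f(p_n,\alpha(n))$ for all $n$; then $F(\alpha)=\beta\in\Delta^{\mathbb{N}}$. For a sequence $\omega$, a nonempty finite string $x$ is a factor if $x=\omega(i)\dots\omega(j)$ for some $i\le j$. A sequence is strongly almost periodic if for every factor $x$ there is $l$ such that every factor of length $l$ contains an occurrence of $x$; it is eventually strongly almost periodic if some suffix $\omega(n)\omega(n+1)\dots$ is strongly almost periodic. *)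

(* Defs.v *)
From mathcomp Require Import all_boot.

Set Implicit Arguments.
Unset Strict Implicit.
Unset Printing Implicit Defensive.

Record automaton (Sigma Delta : finType) := Automaton {
  state : finType;
  init : state;
  trans : state * Sigma -> state * Delta }.

Section Run.
Variables (Sigma Delta : finType) (F : automaton Sigma Delta).
Variable alpha : nat -> Sigma.

Fixpoint run_state (n : nat) : state F :=
  if n is m.+1 then (trans (run_state m, alpha m)).1 else init F.

Definition output (n : nat) : Delta := (trans (run_state n, alpha n)).2.

End Run.

Section AlmostPeriodicity.
Variable T : eqType.
Implicit Types (w : nat -> T) (x y : seq T).

(* Both endpoints are included, so a factor is never empty. *)
Definition factor w x : Prop :=
  exists i j : nat, i <= j /\ x = [seq w k | k <- index_iota i j.+1].

(* The length l must be positive: as factors are nonempty, l = 0 would make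
   the condition on factors of length l vacuous. *)
Definition strongly_almost_periodic w : Prop :=
  forall x, factor w x ->
    exists l : nat, 0 < l /\
      forall y, factor w y -> size y = l -> infix x y.

Definition suffix_from w (n : nat) : nat -> T := fun k => w (n + k).

Definition eventually_strongly_almost_periodic w : Prop :=
  exists n : nat, strongly_almost_periodic (suffix_from w n).

End AlmostPeriodicity.

(* Main.v *)
Require Import Defs.
From mathcomp Require Import all_boot.
From mathcomp Require Import zify.
From Stdlib Require Import Classical.

Set Implicit Arguments.
Unset Strict Implicit.
Unset Printing Implicit Defensive.

(** The joint sequence of states and input letters is eventually strongly
    almost periodic, and the output is its letterwise image.  Choose a factor u
    of the input whose action on the states has image A of minimal size; a path
    from one occurrence of u to a later one then maps A onto A.  Let a be the
    state reached after one occurrence of u, and x the input that follows.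
    For a factor y starting with ux, let B(y) be the set of states in A from
    which, after the initial u, reading y leads to the state a just before some
    occurrence of x preceded by u.  Take y with B(y) largest.  If y occurs later,
    with a state outside B(y) after its initial u, then extending y to the left
    up to the chosen occurrence of u enlarges B(y): the preimage of B(y) is no
    smaller than B(y), and a is added.  Hence every occurrence of y contains the
    state a followed by x, and y occurs with bounded gaps. *)

Lemma exists_minimizer (A : Type) (P : A -> Prop) (f : A -> nat) :
  (exists a, P a) -> exists2 a, P a & forall b, P b -> f a <= f b.
Proof.
case=> a Pa; have [n le_n] := ubnP (f a).
elim: n a Pa le_n => // n IHn a Pa le_n.
case: (classic (exists2 b, P b & f b < f a)) => [[b Pb lt_ba]|no_b].
  by apply: (IHn b Pb); lia.
exists a => // b Pb; rewrite leqNgt; apply/negP => lt_ba.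
by apply: no_b; exists b.
Qed.

Section Blocks.
Variable T : eqType.
Implicit Types w : nat -> T.

Definition block w i n : seq T := [seq w k | k <- iota i n].

Lemma size_block w i n : size (block w i n) = n.
Proof. by rewrite size_map size_iota. Qed.

Lemma blockD w i m n : block w i (m + n) = block w i m ++ block w (i + m) n.
Proof. by rewrite /block iotaD map_cat. Qed.

Lemma blockS w i n : block w i n.+1 = rcons (block w i n) (w (i + n)).
Proof. by rewrite -addn1 blockD cats1. Qed.

Lemma sub_block w d m i n : d + m <= n ->
  block w (i + d) m = take m (drop d (block w i n)).
Proof.
move=> le_n; have -> : n = d + (m + (n - d - m)) by lia.
by rewrite !blockD drop_size_cat ?size_block // take_size_cat ?size_block.
Qed.

Lemma eq_sub_block w d m i j n : d + m <= n ->
  block w i n = block w j n -> block w (i + d) m = block w (j + d) m.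
Proof. by move=> le_n eq_ij; rewrite !(sub_block _ _ le_n) eq_ij. Qed.

Lemma block_suffix w s i n : block (suffix_from w s) i n = block w (s + i) n.
Proof. by rewrite /block iotaDl -map_comp. Qed.

Definition bounded_gaps w i m :=
  exists l, forall k, exists t,
    [/\ k <= t, t + m <= k + l & block w t m = block w i m].

Lemma bounded_gaps_of_sap w i m :
  strongly_almost_periodic w -> 0 < m -> bounded_gaps w i m.
Proof.
move=> sap m_gt0; case: (sap (block w i m)) => [|l [l_gt0 inf_l]].
  by exists i, (i + m).-1; split; [lia | congr map; congr iota; lia].
exists l => k; have /infixP[s [s' def_y]] : infix (block w i m) (block w k l).
  apply: inf_l; last exact: size_block.
  by exists k, (k + l).-1; split; [lia | congr map; congr iota; lia].
have := congr1 size def_y; rewrite !size_cat !size_block => def_l.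
exists (k + size s); split; try lia.
rewrite (@sub_block w (size s) m k l); last by lia.
by rewrite def_y drop_size_cat // take_size_cat ?size_block.
Qed.

(** Prefixes suffice: every factor sits inside a prefix and recurs along with it. *)
Lemma sap_of_bounded_gaps w :
  (forall m, bounded_gaps w 0 m) -> strongly_almost_periodic w.
Proof.
move=> gaps x [i [j [le_ij ->]]].
rewrite -/(block w i (j.+1 - i)).
have [l gap_l] := gaps j.+1; exists l.+1; split=> // y [k [k' [le_k ->]]].
rewrite -/(block w k (k'.+1 - k)) size_block => ->.
have [t [le_kt le_tl eq_t]] := gap_l k.
have -> : block w i (j.+1 - i) = block w (t + i) (j.+1 - i).
  by rewrite -{1}[i]add0n; apply: eq_sub_block (esym eq_t); lia.
have -> : l.+1 = (t + i - k) + ((j.+1 - i) + (k + l.+1 - (t + j.+1))) by lia.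
rewrite !blockD; apply/infixP.
have -> : k + (t + i - k) = t + i by lia.
by eexists; eexists.
Qed.

End Blocks.

Lemma sap_comp (T U : eqType) (g : T -> U) (w : nat -> T) (v : nat -> U) :
  v =1 g \o w -> strongly_almost_periodic w -> strongly_almost_periodic v.
Proof.
move=> def_v sap; apply: sap_of_bounded_gaps => -[|m].
  by exists 0 => k; exists k; split; rewrite ?addn0.
have [l gap_l] := bounded_gaps_of_sap 0 sap (ltn0Sn m).
exists l => k; have [t [le_kt le_tl eq_t]] := gap_l k.
have block_v i : block v i m.+1 = map g (block w i m.+1).
  by rewrite /block -map_comp; apply: eq_map.
by exists t; rewrite !block_v eq_t.
Qed.

Section Run.
Variables (T Q : finType) (step : Q -> T -> Q) (w : nat -> T) (p : nat -> Q).
Hypothesis pS : forall n, p n.+1 = step (p n) (w n).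

Let run q i n := foldl step q (block w i n).

Lemma runD q i m n : run q i (m + n) = run (run q i m) (i + m) n.
Proof. by rewrite /run blockD foldl_cat. Qed.

Lemma run_p i n : run (p i) i n = p (i + n).
Proof.
elim: n => [|n IHn]; first by rewrite addn0.
by rewrite /run blockS foldl_rcons -/(run _ _ _) IHn addnS pS.
Qed.

Let joint n := (p n, w n).

(** By determinism, the state at the start and the letters read fix all later states. *)
Lemma joint_block i j n : p i = p j -> block w i n = block w j n ->
  block joint i n = block joint j n.
Proof.
move=> eq_p; elim: n => // n IHn eq_w.
have eq_n : block w i n = block w j n.
  by rewrite -[i]addn0 -[j]addn0; apply: eq_sub_block eq_w; lia.
rewrite !blockS (IHn eq_n) /joint -!run_p /run eq_n eq_p.
by move: eq_w; rewrite !blockS eq_n => /rcons_inj[->].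
Qed.

Lemma joint_eventually_sap :
  strongly_almost_periodic w -> eventually_strongly_almost_periodic joint.
Proof.
move=> sap.
pose img i n := [set run q i n | q in Q].
have [[i0 lu] _ img_min] := @exists_minimizer (nat * nat) (fun=> True)
  (fun c => #|img c.1 c.2|) (ex_intro _ (0, 0) I).
set A := img i0 lu in img_min.
set a := p (i0 + lu).
(* After this shift, the prefix of length [m] starts in state [a] and its input letters form the
   word x. *)
exists (i0 + lu); apply: sap_of_bounded_gaps => m.
pose occ t := block w t (lu + m) == block w i0 (lu + m).
have img_u t : occ t -> img t lu = A.
  move=> /eqP occ_t; rewrite /A /img /run -[t]addn0 -[i0]addn0.
  by rewrite (@eq_sub_block _ w 0 lu t i0 (lu + m)) //; lia.
have p_A t : occ t -> p (t + lu) \in A.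
  by move=> occ_t; rewrite -(img_u t occ_t) -run_p; apply: imset_f.
(* The factor y of the input is represented by its start s and length n. *)
pose B s n := [set q in A | [exists d : 'I_n.+1,
  [&& d + (lu + m) <= n, occ (s + d) & run q (s + lu) d == a]]].
(* The bound on [d] keeps each occurrence of ux inside the block, so only the letters of the block
   matter. *)
have eq_B s s' n : block w s n = block w s' n -> B s n = B s' n.
  move=> eq_s; apply/setP=> q; rewrite !inE; congr (_ && _).
  apply: eq_existsb => d; case: leqP => //= le_d.
  rewrite /occ (@eq_sub_block _ w d (lu + m) s s' n) //.
  by rewrite /run (@eq_sub_block _ w lu d s s' n) //; lia.
(* Maximizing [B] is minimizing its codimension in [Q]; the subtraction never truncates. *)
have [[s n] /= [occ_s le_n] B_max] := @exists_minimizer (nat * nat)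
  (fun c => occ c.1 /\ lu + m <= c.2) (fun c => #|Q| - #|B c.1 c.2|)
  (ex_intro _ (i0, lu + m) (conj (eqxx _) (leqnn _))).
have hit s' : i0 <= s' -> block w s' n = block w s n ->
    p (s' + lu) \in B s n.
  move=> le_s' eq_s'; rewrite -(eq_B s' s n) //.
  have occ_s' : occ s'.
    rewrite /occ -(eqP occ_s) -[s']addn0 -[s]addn0; apply/eqP.
    by apply: eq_sub_block eq_s'; lia.
  apply: contraT => notB.
  pose e := s' - i0; have def_s' : s' = i0 + e by rewrite /e; lia.
  pose tau q := run q (i0 + lu) e.
  (* The [lu + e] letters from [i0] end with the copy of u at [s'], which gives inclusion in [A];
     minimality of [A] gives equality. *)
  have tauA : tau @: A = A.
    have tau_img : tau @: A = img i0 (lu + e).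
      by rewrite /A /img -imset_comp; apply: eq_imset => q /=; rewrite runD.
    apply/eqP; rewrite eqEcard {2}tau_img (img_min (_, _)) // andbT tau_img.
    rewrite -(img_u s' occ_s'); apply/subsetP=> _ /imsetP[q _ ->].
    by rewrite addnC runD def_s'; apply: imset_f.
  have aA : a \in A by apply: p_A; exact: eqxx.
  have tau_a : tau a = p (s' + lu).
    by rewrite /tau run_p def_s'; congr p; lia.
  pose C := [set q in A | tau q \in B s' n].
  have le_BC : #|B s' n| <= #|C|.
    apply: leq_trans (leq_imset_card tau _); apply: subset_leq_card.
    apply/subsetP=> b bB; have: b \in A by move: bB; rewrite inE => /andP[].
    rewrite -tauA => /imsetP[q qA def_b]; apply/imsetP; exists q => //.
    by rewrite inE qA -def_b.
  (* The state [a] qualifies at offset 0, through the copy of u at [i0]; an offset [d] for [tau q]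
     becomes [e + d] for [q]. *)
  have sub_C : a |: C \subset B i0 (e + n).
    apply/subsetP=> q /setU1P[->|].
      rewrite inE aA; apply/existsP; exists ord0.
      by rewrite /= addn0 /occ /run /= !eqxx; lia.
    rewrite !inE => /and3P[-> _ /existsP[d /and3P[le_d occ_d run_d]]] /=.
    have lt_d : e + d < (e + n).+1 by lia.
    apply/existsP; exists (Ordinal lt_d) => /=.
    have -> : i0 + (e + d) = s' + d by lia.
    rewrite occ_d runD; have -> : i0 + lu + e = s' + lu by lia.
    by rewrite run_d andbT; lia.
  have lt_B : #|B s' n| < #|B i0 (e + n)|.
    apply: leq_ltn_trans le_BC _; apply: leq_trans (subset_leq_card sub_C).
    by rewrite cardsU1 inE tau_a (negbTE notB) andbF.
  have := B_max (i0, e + n); rewrite /= -(eq_B s' s n) // => le_B.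
  have /le_B : occ i0 /\ lu + m <= e + n by split; [exact: eqxx | lia].
  by rewrite leqNgt ltn_sub2l // (leq_trans lt_B (max_card _)).
have [n0|n_gt0] := posnP n.
  have -> : m = 0 by lia.
  by exists 0 => k; exists k; split; rewrite ?addn0.
have [l gap_l] := bounded_gaps_of_sap s sap n_gt0.
(* Searching from [i0 + lu + k] ensures both [i0 <= s'], as [hit] requires, and a shifted position
   [s' + d - i0] of at least [k]. *)
exists l => k; have [s' [le_s' le_l eq_s']] := gap_l (i0 + lu + k).
have le_i0 : i0 <= s' by lia.
have := hit s' le_i0 eq_s'; rewrite -(eq_B s' s n) // inE.
case/andP=> _ /existsP[d /and3P[le_d /eqP occ_d /eqP run_d]].
exists (s' + d - i0); split; try lia.
rewrite !block_suffix addn0.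
have -> : i0 + lu + (s' + d - i0) = s' + d + lu by lia.
apply: joint_block; last by apply: eq_sub_block occ_d; lia.
by rewrite -/a -run_d run_p; congr p; lia.
Qed.

End Run.

Theorem theorem3 (Sigma Delta : finType) (F : automaton Sigma Delta)
    (omega : nat -> Sigma) :
  eventually_strongly_almost_periodic omega ->
  eventually_strongly_almost_periodic (output F omega).
Proof.
case=> n sap.
pose p k := run_state F omega (n + k).
have [k sap_k] : eventually_strongly_almost_periodic
    (fun k => (p k, suffix_from omega n k)).
  apply: (@joint_eventually_sap _ _ (fun q x => (trans (q, x)).1)) => // k.
  by rewrite /p addnS.
exists (n + k); apply: (sap_comp (g := fun c => (trans c).2)) sap_k => i.
by rewrite /= /suffix_from /output /p addnA.
Qed.
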